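(* Let $\Omega$ be an infinite set, $K$ a field, and $V$ a $K$-vector space with basis $\Omega$. Suppose $F$ is a functor from $\mathbf{Set}$ to (i) the category of groups, respectively (ii) the category of monoids, (iii) the category of associative unital algebras over $K$, or (iv) the category of lattices. Suppose that for every set $I$, the algebra $F(I)$ is the union of the images of the homomorphisms $F(a):F(n)\to F(I)$, where $n$ ranges over the natural numbers and $a$ over all set maps $n\to I$. Suppose moreover that the cardinality of $F(\aleph_0)$ in case (i), (ii) or (iv), or its $K$-dimension in case (iii), is $\le\mathrm{card}(\Omega)$. (For instance, starting with an algebra $A$ of cardinality or $K$-dimension $\le\mathrm{card}(\Omega)$, one might define $F$ to be the functor associating to every set $I$ the $I$-fold coproduct of copies of $A$ in some fixed variety or quasivariety containing $A$.) Then $F(2^{\mathrm{card}(\Omega)})$ is embeddable in (i) the group $\mathrm{Sym}(\Omega)$, (ii) the monoid $\mathrm{Self}(\Omega)$, (iii) the $K$-algebra $\mathrm{End}_K(V)$, or (iv) the lattice $\mathrm{Equiv}(\Omega)$, respectively.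
   Context: $\mathrm{Sym}(\Omega)$ is the group of all permutations of $\Omega$; $\mathrm{Self}(\Omega)$ is the monoid of all maps $\Omega\to\Omega$ under composition; $\mathrm{End}_K(V)$ is the associative unital $K$-algebra of $K$-linear endomorphisms of $V$; $\mathrm{Equiv}(\Omega)$ is the lattice of equivalence relations on $\Omega$ ordered by inclusion. ''Embeddable'' means that there is an injective homomorphism of groups, monoids, $K$-algebras, or lattices, respectively. Each natural number $n$ is identified with the set $\{0,\dots,n-1\}$, and a cardinal is regarded as a set of that cardinality. In the parenthetical example, $A$ is a group, monoid, associative unital $K$-algebra, or lattice, and the variety or quasivariety is one of algebras of that same kind.
   Formalization: In case (iii) all algebras F(I) are required to be nonzero, since the constant functor with value the zero algebra is a counterexample; the parenthetical coproduct example is not formalized. *)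

(* Defs.v *)
From HB Require Import structures.
From Stdlib Require Import RelationClasses Relation_Operators.
From mathcomp Require Import all_boot all_order all_algebra.
From mathcomp Require Import boolp classical_sets functions cardinality.

Set Implicit Arguments.
Unset Strict Implicit.
Unset Printing Implicit Defensive.

Import GRing.Theory.
Local Open Scope ring_scope.
Local Open Scope card_scope.

(* [Set] is the category of types of a fixed universe and all maps.  The target
   is a concrete category: objects [C], underlying sets [el], homomorphisms
   [hom], and the map [app f : el A -> el B] underlying [f : hom A B].
   Homomorphisms are compared through their underlying maps. *)
Record set_functor (C : Type) (el : C -> Type) (hom : C -> C -> Type)
    (app : forall A B : C, hom A B -> el A -> el B) := SetFunctor {
  fobj :> Type -> C;
  fmap : forall I J : Type, (I -> J) -> hom (fobj I) (fobj J);
  fmap_id : forall (I : Type) (x : el (fobj I)), app _ _ (fmap (@id I)) x = x;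
  fmap_comp : forall (I J L : Type) (g : J -> L) (f : I -> J) (x : el (fobj I)),
    app _ _ (fmap (g \o f)) x = app _ _ (fmap g) (app _ _ (fmap f) x)
}.

Definition finitary (C : Type) (el : C -> Type) (hom : C -> C -> Type)
    (app : forall A B : C, hom A B -> el A -> el B)
    (F : set_functor app) : Prop :=
  forall (I : Type) (x : el (F I)),
    exists (n : nat) (a : 'I_n -> I) (y : el (F 'I_n)),
      app _ _ (fmap F a) y = x.

Definition group_functor := @set_functor groupType (fun G => G)
  (fun G H => UMagmaMorphism.type G H) (fun G H f => f).

Definition monoid_functor := @set_functor monoidType (fun M => M)
  (fun M N => UMagmaMorphism.type M N) (fun M N f => f).

(* An [algType] is nontrivial ([1 != 0]).  This is needed: the zero algebra has
   no unital homomorphism to [End V] when [V] is nonzero.  Since every [F I]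
   maps to [F (Omega -> bool)], it amounts to [F (Omega -> bool)] being
   nonzero. *)
Definition algebra_functor (K : fieldType) := @set_functor (algType K)
  (fun A => A) (fun A B => {lrmorphism A -> B}) (fun A B f => f).

(* A [latticeType] may be empty and need not have a top or a bottom. *)
Definition lattice_functor (d : Order.disp_t) := @set_functor (latticeType d)
  (fun L => L) (fun L M => {lmorphism L -> M}) (fun L M f => f).

Definition lin_indep (K : fieldType) (V : lmodType K) (B : Type) (b : B -> V) :=
  forall (n : nat) (i : 'I_n -> B) (c : 'I_n -> K), injective i ->
    \sum_(j < n) c j *: b (i j) = 0 -> forall j, c j = 0.

Definition spanning (K : fieldType) (V : lmodType K) (B : Type) (b : B -> V) :=
  forall v : V, exists (n : nat) (i : 'I_n -> B) (c : 'I_n -> K),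
    v = \sum_(j < n) c j *: b (i j).

Definition is_basis (K : fieldType) (V : lmodType K) (B : Type) (b : B -> V) :=
  lin_indep b /\ spanning b.

(* All bases have the same cardinality, so some basis may be used. *)
Definition dim_le (K : fieldType) (V : lmodType K) (T : Type) :=
  exists (B : Type) (b : B -> V), is_basis b /\ [set: B] #<= [set: T].

Record Sym (T : Type) := MkSym { sym_fun :> T -> T; sym_bij : bijective sym_fun }.

HB.instance Definition _ (T : Type) := gen_eqMixin (Sym T).
HB.instance Definition _ (T : Type) := gen_choiceMixin (Sym T).

Section SymGroup.
Variable T : Type.
Implicit Types s t : Sym T.

Lemma sym_ext s t : s =1 t -> s = t.
Proof.
case: s t => [f fP] [g gP] /= /funext fg; case: _ / fg in gP *.
by rewrite (Prop_irrelevance fP gP).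
Qed.

Lemma sym_inv_ex s : exists g : T -> T, cancel s g /\ cancel g s.
Proof. by case: s => f [g fK gK]; exists g. Qed.

Definition sym_inv_fun s : T -> T := sval (cid (sym_inv_ex s)).

Lemma sym_funK s : cancel s (sym_inv_fun s).
Proof. by rewrite /sym_inv_fun; case: cid => g []. Qed.

Lemma sym_inv_funK s : cancel (sym_inv_fun s) s.
Proof. by rewrite /sym_inv_fun; case: cid => g []. Qed.

Definition sym_one : Sym T := @MkSym T id (@Bijective T T id id (frefl id) (frefl id)).
Definition sym_mul s t : Sym T := MkSym (bij_comp (sym_bij s) (sym_bij t)).
Definition sym_inv s : Sym T := MkSym (Bijective (sym_inv_funK s) (sym_funK s)).

Lemma sym_mulA : associative sym_mul.
Proof. by move=> s t u; apply: sym_ext. Qed.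
Lemma sym_mul1 : left_id sym_one sym_mul.
Proof. by move=> s; apply: sym_ext. Qed.
Lemma sym_mulr1 : right_id sym_one sym_mul.
Proof. by move=> s; apply: sym_ext. Qed.
Lemma sym_mulV : left_inverse sym_one sym_inv sym_mul.
Proof. by move=> s; apply: sym_ext => x /=; rewrite sym_funK. Qed.
Lemma sym_mulrV : right_inverse sym_one sym_inv sym_mul.
Proof. by move=> s; apply: sym_ext => x /=; rewrite sym_inv_funK. Qed.

HB.instance Definition _ :=
  isGroup.Build (Sym T) sym_mulA sym_mul1 sym_mulr1 sym_mulV sym_mulrV.

End SymGroup.

Definition Self (T : Type) : Type := T -> T.

HB.instance Definition _ (T : Type) := gen_eqMixin (Self T).
HB.instance Definition _ (T : Type) := gen_choiceMixin (Self T).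

Section SelfMonoid.
Variable T : Type.

Definition self_mul (f g : Self T) : Self T := f \o g.

Lemma self_mulA : associative self_mul. Proof. by []. Qed.
Lemma self_mul1 : left_id (@id T : Self T) self_mul. Proof. by []. Qed.
Lemma self_mulr1 : right_id (@id T : Self T) self_mul. Proof. by []. Qed.

HB.instance Definition _ :=
  isMonoid.Build (Self T) self_mulA self_mul1 self_mulr1.

End SelfMonoid.

Definition End (K : fieldType) (V : lmodType K) : Type := {linear V -> V}.

HB.instance Definition _ (K : fieldType) (V : lmodType K) := gen_eqMixin (End V).
HB.instance Definition _ (K : fieldType) (V : lmodType K) :=
  gen_choiceMixin (End V).

Section EndAlgebra.
Variables (K : fieldType) (V : lmodType K).

Definition end_fun (f : End V) : {linear V -> V} := f.
Implicit Types f g h : End V.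

Lemma end_ext f g : end_fun f =1 end_fun g -> f = g.
Proof.
case: f g => [f [[fD] [fZ]]] [g [[gD] [gZ]]] /= /funext fg.
case: _ / fg in gD gZ *.
by rewrite (Prop_irrelevance fD gD) (Prop_irrelevance fZ gZ).
Qed.

Definition end_zero : End V := [the {linear V -> V} of \0].
Definition end_opp f : End V := [the {linear V -> V} of \- end_fun f].
Definition end_add f g : End V := [the {linear V -> V} of end_fun f \+ end_fun g].
Definition end_one : End V := [the {linear V -> V} of idfun].
Definition end_mul f g : End V := [the {linear V -> V} of end_fun f \o end_fun g].
Definition end_scale (a : K) f : End V := [the {linear V -> V} of a \*: end_fun f].

Lemma end_addA : associative end_add.
Proof. by move=> f g h; apply: end_ext => v; rewrite /= addrA. Qed.
Lemma end_addC : commutative end_add.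
Proof. by move=> f g; apply: end_ext => v; rewrite /= addrC. Qed.
Lemma end_add0 : left_id end_zero end_add.
Proof. by move=> f; apply: end_ext => v; rewrite /= add0r. Qed.
Lemma end_addN : left_inverse end_zero end_opp end_add.
Proof. by move=> f; apply: end_ext => v; rewrite /= addNr. Qed.
Lemma end_mulA : associative end_mul.
Proof. by move=> f g h; apply: end_ext. Qed.
Lemma end_mul1 : left_id end_one end_mul.
Proof. by move=> f; apply: end_ext. Qed.
Lemma end_mulr1 : right_id end_one end_mul.
Proof. by move=> f; apply: end_ext. Qed.
Lemma end_mulDl : left_distributive end_mul end_add.
Proof. by move=> f g h; apply: end_ext. Qed.
Lemma end_mulDr : right_distributive end_mul end_add.
Proof. by move=> f g h; apply: end_ext => v; rewrite /= raddfD. Qed.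

HB.instance Definition _ := GRing.isPzRing.Build (End V)
  end_addA end_addC end_add0 end_addN
  end_mulA end_mul1 end_mulr1 end_mulDl end_mulDr.

Lemma end_scaleA a b f : end_scale a (end_scale b f) = end_scale (a * b) f.
Proof. by apply: end_ext => v; rewrite /= scalerA. Qed.
Lemma end_scale1 : left_id 1 end_scale.
Proof. by move=> f; apply: end_ext => v; rewrite /= scale1r. Qed.
Lemma end_scaleDr : right_distributive end_scale +%R.
Proof. by move=> a f g; apply: end_ext => v; rewrite /= scalerDr. Qed.
Lemma end_scaleDl f : {morph end_scale^~ f : a b / a + b}.
Proof. by move=> a b; apply: end_ext => v; rewrite /= scalerDl. Qed.

HB.instance Definition _ := GRing.Zmodule_isLmodule.Build K (End V)
  end_scaleA end_scale1 end_scaleDr end_scaleDl.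

(* [End V] is the zero ring when [V] is trivial, so it is only registered as a
   [pzRingType] and an [lmodType]; these are the remaining algebra laws. *)
Lemma end_scaleAl (a : K) (f g : End V) : a *: (f * g) = (a *: f) * g.
Proof. by apply: end_ext. Qed.
Lemma end_scaleAr (a : K) (f g : End V) : a *: (f * g) = f * (a *: g).
Proof. by apply: end_ext => v; rewrite /= linearZ. Qed.

End EndAlgebra.

Record Equiv (T : Type) := MkEquiv {
  equiv_rel :> T -> T -> Prop;
  equiv_equiv : Equivalence equiv_rel
}.

HB.instance Definition _ (T : Type) := gen_eqMixin (Equiv T).
HB.instance Definition _ (T : Type) := gen_choiceMixin (Equiv T).

Fact equiv_display : Order.disp_t. Proof. exact: Order.Disp tt tt. Qed.

Section EquivLattice.
Variable T : Type.
Implicit Types R S U : Equiv T.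

Lemma equiv_ext R S : (forall x y, R x y <-> S x y) -> R = S.
Proof.
case: R S => [R RP] [S SP] /= RS.
have {}RS : R = S by apply/funext => x; apply/funext => y; apply/propext.
by case: _ / RS in SP *; rewrite (Prop_irrelevance RP SP).
Qed.

Definition equiv_le R S : bool := `[< forall x y, R x y -> S x y >].

Lemma equiv_le_refl : reflexive equiv_le.
Proof. by move=> R; apply/asboolP. Qed.
Lemma equiv_le_anti : antisymmetric equiv_le.
Proof.
move=> R S /andP[/asboolP RS /asboolP SR]; apply: equiv_ext => x y.
by split; [apply: RS | apply: SR].
Qed.
Lemma equiv_le_trans : transitive equiv_le.
Proof.
move=> S R U /asboolP RS /asboolP SU; apply/asboolP => x y /RS; exact: SU.
Qed.

HB.instance Definition _ := Order.Le_isPOrder.Build equiv_display (Equiv T)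
  equiv_le_refl equiv_le_anti equiv_le_trans.

Definition meet_rel R S (x y : T) : Prop := R x y /\ S x y.
Definition join_rel R S : T -> T -> Prop :=
  clos_trans T (fun x y => R x y \/ S x y).

Lemma meet_rel_equiv R S : Equivalence (meet_rel R S).
Proof.
case: R S => [R [Rr Rs Rt]] [S [Sr Ss St]]; rewrite /meet_rel /=; split.
- by move=> x; split; [apply: Rr | apply: Sr].
- by move=> x y [xRy xSy]; split; [apply: Rs | apply: Ss].
- move=> x y z [xRy xSy] [yRz ySz].
  by split; [apply: Rt yRz | apply: St ySz].
Qed.

Lemma join_rel_equiv R S : Equivalence (join_rel R S).
Proof.
case: R S => [R [Rr Rs Rt]] [S [Sr Ss St]]; rewrite /join_rel /=; split.
- by move=> x; apply: t_step; left; apply: Rr.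
- move=> x y; elim=> [u v [uv|uv]|u v w _ vu _ wv].
  + by apply: t_step; left; apply: Rs.
  + by apply: t_step; right; apply: Ss.
  + exact: t_trans wv vu.
- by move=> x y z; apply: t_trans.
Qed.

Definition equiv_meet R S : Equiv T := MkEquiv (meet_rel_equiv R S).
Definition equiv_join R S : Equiv T := MkEquiv (join_rel_equiv R S).

Lemma equiv_meetP R S U :
  (R <= equiv_meet S U)%O = (R <= S)%O && (R <= U)%O.
Proof.
apply/asboolP/andP => [RSU|[/asboolP RS /asboolP RU] x y xRy].
  by split; apply/asboolP => x y /RSU[].
by split; [apply: RS | apply: RU].
Qed.

Lemma equiv_joinP R S U :
  (equiv_join R S <= U)%O = (R <= U)%O && (S <= U)%O.
Proof.
apply/asboolP/andP => [RSU|[/asboolP RU /asboolP SU] x y].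
  by split; apply/asboolP => x y xy; apply: RSU; apply: t_step; [left | right].
elim=> [u v [/RU|/SU] //|u v w _ uv _ vw].
by have [_ _ Ut] := equiv_equiv U; apply: Ut vw.
Qed.

HB.instance Definition _ := Order.POrder_MeetJoin_isLattice.Build
  equiv_display (Equiv T) equiv_meetP equiv_joinP.

End EquivLattice.

(* Main.v *)
(* Consider the maps [c : (Omega -> bool) -> nat] sending a point to a code of
   its restriction to a finite list of coordinates.  There are card Omega many of
   them and they separate finite sets of points, so, [F] being finitary, the
   homomorphisms [F c] are jointly injective and [F (Omega -> bool)] embeds in
   the power [A ^ Omega] of [A := F nat].  This power embeds in the target because
   card Omega many representations of [A] of size at most card Omega can be placed
   side by side: the regular representation for groups, monoids and algebras, and
   for lattices the representation by equivalence relations given by Whitman's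
   theorem, obtained by Jonsson's method on a carrier of the right cardinality. *)
Require Import Defs.
From HB Require Import structures.
From Stdlib Require Import RelationClasses Relation_Operators.
From mathcomp Require Import all_boot all_order all_algebra.
From mathcomp Require Import boolp classical_sets functions cardinality.

Set Implicit Arguments.
Unset Strict Implicit.
Unset Printing Implicit Defensive.

Local Open Scope card_scope.

(** * Cardinality *)

Section Cardinality.
Local Open Scope classical_set_scope.

Definition embeds (T U : Type) : Prop := exists f : T -> U, injective f.

Lemma embedsP (T U : Type) : [set: T] #<= [set: U] <-> embeds T U.
Proof.
split=> [/card_leP[f]|[f f_inj]].
  exists (fun x => val (f (SigSub (mem_set (Logic.I : [set: T] x))))).
  move=> x y fxy.
  by have /(congr1 val) := inj (in_setT _) (in_setT _) (val_inj fxy).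
have /injfunPex[g] : exists2 g : T -> U,
    set_fun [set: T] [set: U] g & set_inj [set: T] g.
  by exists f => // x y _ _; apply: f_inj.
exact: inj_card_le g.
Qed.

Lemma embeds_trans (T U W : Type) : embeds T U -> embeds U W -> embeds T W.
Proof. by move=> [f fI] [g gI]; exists (g \o f); apply: inj_comp. Qed.

Lemma embeds_antisym (T U : Type) :
  embeds T U -> embeds U T -> exists f : T -> U, bijective f.
Proof.
move=> /embedsP TU /embedsP UT.
have /card_bijP[f f_bij] := Cantor_Bernstein TU UT.
pose toT (W : Type) (x : W) : [set: W] :=
  SigSub (mem_set (Logic.I : [set: W] x)).
have bij_toT W : bijective (@toT W) by exists val => // x; apply: val_inj.
have bij_val W : bijective (val : [set: W] -> W).
  by exists (@toT W) => // x; apply: val_inj.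
by exists (val \o f \o @toT T); apply/bij_comp/bij_toT/bij_comp/f_bij.
Qed.

(** By Zorn's lemma there is a maximal graph of a partial injection; if it missed a point on each
    side, that pair could be added. *)
Lemma embeds_comparable (T U : Type) : embeds T U \/ embeds U T.
Proof.
pose P (R : set (T * U)) := forall x y x' y',
  R (x, y) -> R (x', y') -> x = x' <-> y = y'.
have [F FP Ftot|R [RP Rmax]] := @Zorn_bigcup _ P.
  move=> x y x' y' [R FR Rxy] [S FS Sxy].
  have [RS|SR] := Ftot _ _ FR FS.
    by apply: (FP _ FS) => //; apply: RS.
  by apply: (FP _ FR) => //; apply: SR.
have [Rtot|/existsNP[x /forallNP Rx]] := pselect (forall x, exists y, R (x, y)).
  left; have [f fR] := choice Rtot; exists f => x x' fxx'.
  by apply/(RP _ _ _ _ (fR x) (fR x')).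
have [Rsurj|/existsNP[y /forallNP Ry]] :=
  pselect (forall y, exists x, R (x, y)).
  right; have [g gR] := choice Rsurj; exists g => y y' gyy'.
  by apply/(RP _ _ _ _ (gR y) (gR y')).
case: (Rmax (R `|` [set (x, y)])).
  split; first by move=> p; left.
  by move=> /(_ (x, y))/(_ (or_intror erefl)) /Rx.
move=> u v u' v' [Ruv|[-> ->]] [Ruv'|[-> ->]] //.
- exact: RP.
- by split=> uv; [case: (Rx v) | case: (Ry u)]; rewrite -uv.
- by split=> uv; [case: (Rx v') | case: (Ry u')]; rewrite uv.
Qed.

(** * Squares of infinite sets *)

Section Pairing.
Variable T : Type.
Implicit Types (A : set T) (S : set (T * T * T)).

(* [S] is the graph of an injection [A * A -> A], where [A] is [dom S], the set
   of [x] such that the graph is defined at [(x, x)]. *)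
Definition dom S : set T := [set x | exists z, S (x, x, z)].

Definition pairing S : Prop :=
  [/\ forall x y, dom S x -> dom S y -> exists z, S (x, y, z),
      forall x y z, S (x, y, z) -> [/\ dom S x, dom S y & dom S z],
      forall x y z z', S (x, y, z) -> S (x, y, z') -> z = z'
    & forall x y x' y' z, S (x, y, z) -> S (x', y', z) -> x = x' /\ y = y'].

(** Each axiom involves at most two triples of the union, and in a chain these lie in a common
    member. *)
Lemma pairing_bigcup (F : set (set (T * T * T))) :
  F `<=` pairing -> total_on F subset -> pairing (\bigcup_(S in F) S).
Proof.
move=> FP Ftot.
have sub_dom S S' : S `<=` S' -> dom S `<=` dom S'.
  by move=> SS' x [z] /SS' ?; exists z.
have big S : F S -> dom S `<=` dom (\bigcup_(S in F) S).
  by move=> FS; apply: sub_dom => p Sp; exists S.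
have two S S' : F S -> F S' -> exists S0, [/\ F S0, S `<=` S0 & S' `<=` S0].
  by move=> FS FS'; have [?|?] := Ftot _ _ FS FS'; [exists S'|exists S]; split.
split.
- move=> x y [u [S FS Sx]] [v [S' FS' Sy]].
  have [S0 [FS0 SS0 SS0']] := two _ _ FS FS'.
  have [S0tot _ _ _] := FP _ FS0.
  have [z Sz] := S0tot x y (ex_intro _ u (SS0 _ Sx)) (ex_intro _ v (SS0' _ Sy)).
  by exists z, S0.
- move=> x y z [S FS Sxyz]; have [_ Sf _ _] := FP _ FS.
  by have [? ? ?] := Sf _ _ _ Sxyz; split; apply: big FS _ _.
- move=> x y z z' [S FS Sz] [S' FS' Sz'].
  have [S0 [FS0 SS0 SS0']] := two _ _ FS FS'.
  by have [_ _ S0fun _] := FP _ FS0; apply: S0fun (SS0 _ Sz) (SS0' _ Sz').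
- move=> x y x' y' z [S FS Sz] [S' FS' Sz'].
  have [S0 [FS0 SS0 SS0']] := two _ _ FS FS'.
  by have [_ _ _ S0inj] := FP _ FS0; apply: S0inj (SS0 _ Sz) (SS0' _ Sz').
Qed.

End Pairing.

(* Hessenberg's theorem.  A maximal injection [A * A -> A] with [A] infinite has
   [A] of full cardinality: otherwise a copy [B] of [A] outside [A] exists, and
   [(A + B) * (A + B)] minus [A * A] can be sent injectively into [B]. *)
Lemma embeds_square (T : Type) : embeds nat T -> embeds (T * T) T.
Proof.
move=> [i i_inj].
pose S0 : set (T * T * T) :=
  [set p | exists m n, p = (i m, i n, i (pickle (m, n)))].
(* Adjoining [S0], a pairing on the copy of [nat], keeps the domain of the maximal pairing
   infinite. *)
pose P S := pairing (S0 `|` S).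
have pickle_inj : injective (pickle : nat * nat -> nat).
  exact: pcan_inj pickleK.
have S0P : pairing S0.
  split.
  - move=> x y [z [m [n [-> _ _]]]] [z' [m' [n' [-> _ _]]]].
    by eexists; exists m, m'.
  - move=> x y z [m [n [-> -> ->]]].
    by split; eexists; do 2!eexists; reflexivity.
  - by move=> x y z z' [m [n [-> -> ->]]] [m' [n' [/i_inj-> /i_inj-> ->]]].
  - move=> x y x' y' z [m [n [-> -> ->]]] [m' [n' [-> -> /i_inj]]].
    by move=> /pickle_inj[-> ->].
have [F FP Ftot|S [SP Smax]] := @Zorn_bigcup _ P.
  (* The empty chain is separate: the union of its enlarged members would lose [S0]. *)
  have [->|/set0P[S FS]] := eqVneq F set0.
    by rewrite /P bigcup_set0 setU0.
  rewrite /P; have -> : S0 `|` \bigcup_(S in F) S =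
      \bigcup_(S in [set S0 `|` S | S in F]) S.
    apply/seteqP; split=> p.
      by case=> [S0p|[S' FS' Sp]]; [exists (S0 `|` S); [exists S|left]
        |exists (S0 `|` S'); [exists S'|right]].
    by case=> _ [S' FS' <-] [S0p|Sp]; [left|right; exists S'].
  apply: pairing_bigcup => [_ [S' FS' <-]|_ _ [S1 FS1 <-] [S2 FS2 <-]].
    exact: FP.
  by have [?|?] := Ftot _ _ FS1 FS2; [left | right]; apply: setUS.
pose G := S0 `|` S; pose A := dom G.
have {SP} [Gtot Gdom Gfun Ginj] : pairing G by [].
have Ai n : A (i n) by eexists; left; do 2!eexists; reflexivity.
have [p pG] : exists p : T -> T -> T, forall x y, A x -> A y -> G (x, y, p x y).
  have := choice (fun xy : T * T => _ : exists z, A xy.1 -> A xy.2 ->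
    G (xy.1, xy.2, z)).
  case=> [[x y]|p pG]; last first.
    by exists (fun x y => p (x, y)) => x y; apply: pG (x, y).
  have [[/= Ax Ay]|nA] := pselect (A x /\ A y); last first.
    by exists x => ? ?; case: nA.
  by have [z] := Gtot _ _ Ax Ay; exists z.
have Ap x y : A x -> A y -> A (p x y).
  by move=> Ax Ay; have [] := Gdom _ _ _ (pG _ _ Ax Ay).
have p_inj x y x' y' : A x -> A y -> A x' -> A y' -> p x y = p x' y' ->
    x = x' /\ y = y'.
  move=> Ax Ay Ax' Ay' pE; apply: Ginj (pG _ _ Ax Ay) _.
  by rewrite pE; apply: pG.
(* It suffices to embed [T] in [A + A]. *)
suff [h [hA h_inj]] : exists h : T -> T * bool,
    (forall x, A (h x).1) /\ injective h.
  pose e x := p (h x).1 (i (h x).2).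
  have Ae x : A (e x) by apply: Ap.
  have e_inj : injective e.
    move=> x y /p_inj[] // h1 /i_inj h2; apply: h_inj.
    rewrite [LHS]surjective_pairing h1 [RHS]surjective_pairing.
    by case: (h x).2 (h y).2 h2 => -[].
  exists (fun xy => p (e xy.1) (e xy.2)) => -[x y] [x' y'] /=.
  by move=> /p_inj[] // /e_inj-> /e_inj->.
(* If the complement of [A] embeds in [A], a bit tells the two halves of [T] apart; otherwise [A]
   embeds in its complement, against maximality. *)
have [[g gI]|[g gI]] := embeds_comparable {x | A x} {x | ~ A x}; last first.
  exists (fun x => match pselect (A x) return T * bool with
                   | left _ => (x, true)
                   | right nAx => (sval (g (exist _ x nAx)), false) end).
  split=> [x|x y]; first by case: pselect => //= nAx; case: (g _).
  case: pselect => [Ax|nAx]; case: pselect => [Ay|nAy] //; first by case.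
  by case=> /eq_sig_hprop gE; have /gI[] := gE (fun=> @Prop_irrelevance _).
exfalso.
pose k (x : T) : T :=
  match pselect (A x) with left Ax => sval (g (exist _ x Ax)) | _ => x end.
have nAk x : A x -> ~ A (k x).
  by rewrite /k; case: pselect => // Ax _; case: (g _).
have k_inj x y : A x -> A y -> k x = k y -> x = y.
  rewrite /k; case: pselect => // Ax _; case: pselect => // Ay _.
  move=> /eq_sig_hprop gE.
  by have /gI[] := gE (fun=> @Prop_irrelevance _).
pose AB := A `|` [set k x | x in A].
pose dec (a : T * bool) := if a.2 then a.1 else k a.1.
have /choice[h hP] (x : T) : exists a : T * bool, AB x -> A a.1 /\ dec a = x.
  have [[Ax|[a Aa kax]]|nABx] := pselect (AB x).
  - by exists (x, true).
  - by exists (a, false).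
  - by exists (x, true).
have hA x : AB x -> A (h x).1 by case/hP.
have h_inj x y : AB x -> AB y ->
    (h x).1 = (h y).1 -> (h x).2 = (h y).2 -> x = y.
  by move=> /hP[_ hx] /hP[_ hy] h1 h2; rewrite -hx -hy /dec h1 h2.
(* A point of [AB] is a point of [A] with a bit, so a pair is coded in [A] by two points and two
   bits, the bits entering through the copy of [nat]. *)
pose c x y := p (h x).1 (p (h y).1 (i (pickle ((h x).2, (h y).2)))).
have cA x y : AB x -> AB y -> A (c x y).
  by move=> /hA ? /hA ?; do 2!apply: (Ap) => //.
have c_inj x y x' y' : AB x -> AB y -> AB x' -> AB y' -> c x y = c x' y' ->
    x = x' /\ y = y'.
  move=> ABx ABy ABx' ABy' /p_inj[];
    [exact: hA|exact/Ap/Ai/hA|exact: hA|exact/Ap/Ai/hA|].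
  move=> hx /p_inj[]; [exact: hA|exact: Ai|exact: hA|exact: Ai|].
  move=> hy /i_inj /(pcan_inj pickleK)[hx2 hy2].
  by split; apply: h_inj.
(* The new values lie in the image of [k], off [A], so they clash with no value of [G]. *)
pose N := [set xyz : T * T * T | [/\ AB xyz.1.1, AB xyz.1.2,
  ~ (A xyz.1.1 /\ A xyz.1.2) & xyz.2 = k (c xyz.1.1 xyz.1.2)]].
have kAB a : A a -> AB (k a) by move=> Aa; right; exists a.
have ABdom : dom (G `|` N) = AB.
  apply/seteqP; split=> x.
    by case=> z [Gx|[]//]; left; exists z.
  have [[z Gz] _|nAx ABx] := pselect (A x); first by exists z; left.
  by exists (k (c x x)); right; split=> // -[].
apply: (Smax (S `|` N)); last first.
  rewrite /P setUA -/G; split; rewrite ?ABdom.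
  - move=> x y ABx ABy; have [[Ax Ay]|nA] := pselect (A x /\ A y).
      by exists (p x y); left; apply: pG.
    by exists (k (c x y)); right.
  - move=> x y z [/Gdom[]|[/= ABx ABy _ ->]]; first by split; left.
    by split=> //; apply/kAB/cA.
  - move=> x y z z' [Gz|[/= ABx ABy nA ->]] [Gz'|[/= _ _ nA' ->]] //.
    + exact: Gfun Gz Gz'.
    + by case: nA'; have [] := Gdom _ _ _ Gz.
    + by case: nA; have [] := Gdom _ _ _ Gz'.
  - move=> x y x' y' z [Gz|[/= ABx ABy nA ->]] [Gz'|[/= ABx' ABy' nA' zE]].
    + exact: Ginj Gz Gz'.
    + have [_ _] := Gdom _ _ _ Gz.
      by rewrite zE => Ak; case: (nAk _ (cA _ _ ABx' ABy')).
    + by have [_ _ Ak] := Gdom _ _ _ Gz'; case: (nAk _ (cA _ _ ABx ABy)).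
    + by apply: c_inj => //; apply: k_inj zE; apply: cA.
split; first by move=> x; left.
move=> NS; have nAki := nAk _ (Ai 0).
have /NS Ski : (S `|` N) (k (i 0), k (i 0), k (c (k (i 0)) (k (i 0)))).
  by right; split=> [||[]|] //=; apply/kAB/Ai.
by apply: nAki; exists (k (c (k (i 0)) (k (i 0)))); right.
Qed.

Lemma embeds_prod (T U O : Type) :
  embeds nat O -> embeds T O -> embeds U O -> embeds (T * U) O.
Proof.
move=> /embeds_square OO [f fI] [g gI]; apply: embeds_trans OO.
by exists (fun p => (f p.1, g p.2)) => -[x y] [x' y'] /= [/fI-> /gI->].
Qed.

Lemma embeds_sigT (X : nat -> Type) (O : Type) :
  embeds nat O -> (forall n, embeds (X n) O) -> embeds {n & X n} O.
Proof.
move=> natO XO.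
have [f fI] : exists f : forall n, X n -> O, forall n, injective (f n).
  by exists (fun n => sval (cid (XO n))) => n; apply: (svalP (cid (XO n))).
suff : embeds {n & X n} (nat * O).
  by move=> /embeds_trans; apply; apply: embeds_prod => //; exists id.
exists (fun p => (projT1 p, f _ (projT2 p))) => -[n x] [m y] /= [nm].
by case: _ / nm in y * => /fI->.
Qed.

Lemma embeds_sum (T U O : Type) :
  embeds nat O -> embeds T O -> embeds U O -> embeds (T + U) O.
Proof.
move=> natO [f fI] [g gI].
suff : embeds (T + U) (nat * O).
  by move=> /embeds_trans; apply; apply: embeds_prod => //; exists id.
exists (fun p => match p with inl x => (0, f x) | inr y => (1, g y) end).
by case=> [x|x] [y|y] // []; [move=> /fI-> | move=> /gI->].
Qed.

Lemma embeds_seq (T O : Type) : embeds nat O -> embeds T O -> embeds (seq T) O.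
Proof.
move=> natO [f fI]; have [i _] := natO; have [p pI] := embeds_square natO.
suff : embeds (seq T) (nat * O).
  by move=> /embeds_trans; apply; apply: embeds_prod => //; exists id.
(* The size is recorded because the iterated pairing need not show where the list ends. *)
exists (fun s => (size s, foldr (fun x o => p (f x, o)) (i 0) s)).
elim=> [|x s IHs] [|y t] //= [sz /pI[/fI-> o]].
by rewrite (IHs t) // sz o.
Qed.

End Cardinality.

(** * Separating elements of F (Omega -> bool) *)

Definition jointly_injective (I A B : Type) (phi : I -> A -> B) : Prop :=
  forall x y, (forall i, phi i x = phi i y) -> x = y.

(* Finitely many points of [O -> bool] are separated by a map to [nat] that only
   depends on finitely many coordinates; such a map has a left inverse on these
   points, so by functoriality it separates the elements of [F (O -> bool)]
   supported on them. *)
Lemma finitary_separation (C : Type) (el : C -> Type) (hom : C -> C -> Type)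
    (app : forall A B : C, hom A B -> el A -> el B) (F : set_functor app)
    (O : Type) :
  finitary F -> embeds nat O ->
  exists c : O -> (O -> bool) -> nat,
    jointly_injective (fun o => app _ _ (fmap F (c o))).
Proof.
move=> finF natO.
have [e eI] : embeds (seq O) O by apply: embeds_seq => //; exists id.
pose code (s : seq O) (f : O -> bool) : nat := pickle (map f s).
have sep (J : finType) (p : J -> O -> bool) :
    exists (s : seq O) (r : nat -> O -> bool), forall j, r (code s (p j)) = p j.
  have [i _] := natO.
  (* One coordinate per pair of indices, telling the two points apart if they differ; [i 0] is a
     default for equal points. *)
  have /choice[o oP] (q : J * J) : exists o, p q.1 o = p q.2 o -> p q.1 = p q.2.
    have [pq|/existsNP[o opq]] := pselect (p q.1 =1 p q.2); last by exists o.
    by exists (i 0) => _; apply/funext.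
  exists (map o (enum [set: J * J]%SET)).
  set s := map o _.
  have sP j j' : code s (p j) = code s (p j') -> p j = p j'.
    move=> /(pcan_inj pickleK); rewrite -!map_comp => /eq_in_map/(_ (j, j')).
    by rewrite mem_enum inE => /(_ isT) pp; apply: (oP (j, j')).
  have /choice[r rP] (n : nat) : exists f, forall j, code s (p j) = n -> f = p j.
    have [[j jn]|nJ] := pselect (exists j, code s (p j) = n).
      by exists (p j) => j' j'n; apply: sP; rewrite jn.
    by exists (fun=> false) => j jn; case: nJ; exists j.
  by exists r => j; apply: rP.
(* Lists of coordinates are indexed by [O] through [e]; indices off the range of [e] get the empty
   list. *)
exists (fun o => code (if pselect (exists s, e s = o) is left h
                       then sval (cid h) else [::])) => x y xy.
have [n [a [x0 xE]]] := finF _ x; have [m [b [y0 yE]]] := finF _ y.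
(* The supports of [x] and [y] are joined so that a single [s] and [r] serve both. *)
pose p (j : 'I_n + 'I_m) := match j with inl k => a k | inr k => b k end.
have [s [r rs]] := sep _ p.
have {xy} : app _ _ (fmap F (code s)) x = app _ _ (fmap F (code s)) y.
  have := xy (e s); case: pselect => [h|[]]; last by exists s.
  by case: cid => t /= /eI->.
move=> /(congr1 (app _ _ (fmap F r))); rewrite -xE -yE -!fmap_comp.
have -> : r \o code s \o a = a.
  by apply/funext => k; apply: (rs (inl k)).
have -> // : r \o code s \o b = b.
by apply/funext => k; apply: (rs (inr k)).
Qed.

(** * Groups and monoids *)

Section DisjointUnionAction.
Variables (I A O : Type) (e : I * A -> O).
Hypothesis e_inj : injective e.

(** Points off the copies of [A] are fixed, so that identities and composites are preserved although
    [e] need not be onto. *)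
Definition union_act (h : I -> A -> A) (o : O) : O :=
  match pselect (exists q, e q = o) with
  | left ex => let q := sval (cid ex) in e (q.1, h q.1 q.2)
  | right _ => o
  end.

Lemma union_actE h i a : union_act h (e (i, a)) = e (i, h i a).
Proof.
rewrite /union_act; case: pselect => [ex|[]]; last by exists (i, a).
by case: cid => q /= /e_inj->.
Qed.

Lemma union_act_out h o : ~ (exists q, e q = o) -> union_act h o = o.
Proof. by rewrite /union_act; case: pselect. Qed.

Lemma union_act_comp h h' o :
  union_act (fun i => h i \o h' i) o = union_act h (union_act h' o).
Proof.
have [[[i a] <-]|oute] := pselect (exists q, e q = o).
  by rewrite !union_actE.
by rewrite !union_act_out.
Qed.

Lemma union_act_id : union_act (fun=> id) = id.
Proof.
apply/funext=> o; have [[[i a] <-]|oute] := pselect (exists q, e q = o).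
  by rewrite union_actE.
by rewrite union_act_out.
Qed.

End DisjointUnionAction.

Section CayleyEmbedding.
Local Open Scope group_scope.
Variables (M A : monoidType) (I O : Type) (phi : I -> UMagmaMorphism.type M A).
Hypothesis phi_inj : jointly_injective phi.
Variable e : I * A -> O.
Hypothesis e_inj : injective e.

Definition cayley (x : M) : O -> O := union_act e (fun i => *%g (phi i x)).

Lemma cayley1 : cayley 1 = id.
Proof.
rewrite /cayley -(union_act_id e_inj); congr union_act.
by apply/funext => i; apply/funext => a; rewrite gmulf1 mul1g.
Qed.

Lemma cayleyM x y : cayley (x * y) = cayley x \o cayley y.
Proof.
apply/funext => o; rewrite /cayley /= -union_act_comp //; congr union_act.
by apply/funext => i; apply/funext => a; rewrite gmulfM /= mulgA.
Qed.

(** The image of the unit in copy [i] recovers [phi i x]. *)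
Lemma cayley_inj : injective cayley.
Proof.
move=> x y xy; apply: phi_inj => i; have := congr1 (@^~ (e (i, 1))) xy.
by rewrite /= /cayley !union_actE // => /e_inj[]; rewrite !mulg1.
Qed.

End CayleyEmbedding.

Lemma Self_embedding (M A : monoidType) (I O : Type)
    (phi : I -> UMagmaMorphism.type M A) :
  jointly_injective phi -> embeds (I * A) O ->
  exists f : UMagmaMorphism.type M (Self O), injective f.
Proof.
move=> phi_inj [e e_inj].
pose f : M -> Self O := cayley phi e.
have fM : {morph f : x y / (x * y)%g} by move=> x y; apply: cayleyM.
have f1 : f 1%g = 1%g by apply: cayley1.
pose F : UMagmaMorphism.type M (Self O) :=
  HB.pack f (isUMagmaMorphism.Build M (Self O) f (conj f1 fM)).
by exists F; apply: cayley_inj.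
Qed.

Lemma Sym_embedding (G A : groupType) (I O : Type)
    (phi : I -> UMagmaMorphism.type G A) :
  jointly_injective phi -> embeds (I * A) O ->
  exists f : UMagmaMorphism.type G (Sym O), injective f.
Proof.
move=> phi_inj [e e_inj].
have cV x : cancel (cayley phi e x) (cayley phi e x^-1%g).
  move=> o; have /(congr1 (@^~ o)) := cayleyM phi e_inj x^-1%g x.
  by rewrite mulVg cayley1 //= => <-.
have bij x : bijective (cayley phi e x).
  by exists (cayley phi e x^-1%g) => //; rewrite -{2}(invgK x).
pose f (x : G) : Sym O := MkSym (bij x).
have fM : {morph f : x y / (x * y)%g}.
  by move=> x y; apply: sym_ext => o; rewrite /= cayleyM.
have f1 : f 1%g = 1%g by apply: sym_ext => o; rewrite /= cayley1.
pose F : UMagmaMorphism.type G (Sym O) :=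
  HB.pack f (isUMagmaMorphism.Build G (Sym O) f (conj f1 fM)).
exists F => x y /(congr1 (@sym_fun O)); exact: cayley_inj.
Qed.

(** * Algebras *)

Section LinearExtension.
Local Open Scope ring_scope.
Import GRing.Theory.
Variables (K : fieldType) (V W : lmodType K) (B : Type) (b : B -> V).

(** [lin_indep] speaks of injective families only; this collects repeated indices. [{classic B}]
    supplies the equality test for [undup]. *)
Lemma injective_factorization (n : nat) (i : 'I_n -> B) :
  exists (m : nat) (i' : 'I_m -> B) (p : 'I_n -> 'I_m),
    injective i' /\ i = i' \o p.
Proof.
pose i0 : 'I_n -> {classic B} := i; pose s := undup (codom i0).
have ind j : (index (i0 j) s < size s)%N by rewrite index_mem mem_undup codom_f.
exists (size s), (fun k => tnth (in_tuple s) k), (fun j => Ordinal (ind j)).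
split; last first.
  apply/funext => j; rewrite /= (tnth_nth (i0 j)) /= nth_index //.
  by rewrite mem_undup codom_f.
move=> k l; pose x0 := tnth (in_tuple s) k; rewrite !(tnth_nth x0) /= => kl.
apply/val_inj/eqP.
by rewrite -(nth_uniq x0 (ltn_ord k) (ltn_ord l) (undup_uniq _)); apply/eqP.
Qed.

Lemma lin_indep_sum_eq0 (w : B -> W) (n : nat) (i : 'I_n -> B) (c : 'I_n -> K) :
  lin_indep b -> \sum_(j < n) c j *: b (i j) = 0 ->
  \sum_(j < n) c j *: w (i j) = 0.
Proof.
move=> b_free; have [m [i' [p [i'I ->]]]] := injective_factorization i.
have collect (U : lmodType K) (g : B -> U) :
    \sum_(j < n) c j *: g (i' (p j)) =
    \sum_(k < m) (\sum_(j < n | p j == k) c j) *: g (i' k).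
  rewrite (partition_big p predT) //=; apply: eq_bigr => k _.
  by rewrite scaler_suml; apply: eq_bigr => j /eqP->.
rewrite !collect => /(b_free _ _ _ i'I) d0.
by rewrite big1 // => k _; rewrite d0 scale0r.
Qed.

Lemma linear_ext_eq (f g : {linear V -> W}) :
  spanning b -> (forall i, f (b i) = g (b i)) -> f =1 g.
Proof.
move=> b_span fg v; have [n [i [c ->]]] := b_span v.
by rewrite !linear_sum; apply: eq_bigr => j _; rewrite !linearZ /= fg.
Qed.

(** The pairs of combinations with equal coefficients form a linear relation; by independence it
    relates 0 only to 0, so it is a graph. *)
Lemma linear_extension (w : B -> W) :
  is_basis b -> exists f : {linear V -> W}, forall i, f (b i) = w i.
Proof.
move=> [b_free b_span].
pose Gr v u := exists n (i : 'I_n -> B) (c : 'I_n -> K),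
  v = \sum_(j < n) c j *: b (i j) /\ u = \sum_(j < n) c j *: w (i j).
have GrD v u v' u' (a : K) :
    Gr v u -> Gr v' u' -> Gr (a *: v + v') (a *: u + u').
  move=> [n [i [c [-> ->]]]] [n' [i' [c' [-> ->]]]].
  have spl k : fintype.split (lshift n' k) = inl k := unsplitK (inl k).
  have spr k : fintype.split (rshift n k) = inr k := unsplitK (inr k).
  exists (n + n')%N.
  exists (fun j => match fintype.split j with inl k => i k | inr k => i' k end).
  exists (fun j =>
    match fintype.split j with inl k => a * c k | inr k => c' k end).
  by rewrite !big_split_ord !scaler_sumr /=; split; congr +%R;
    apply: eq_bigr => j _; rewrite ?spl ?spr ?scalerA.
have Gr0 u : Gr 0 u -> u = 0.
  by move=> [n [i [c [/esym v0 ->]]]]; apply: lin_indep_sum_eq0 v0.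
have Gr_fun v u u' : Gr v u -> Gr v u' -> u = u'.
  move=> Gu Gu'; apply/eqP; rewrite -subr_eq0 addrC -(scaleN1r u').
  apply/eqP/Gr0.
  by have := GrD _ _ _ _ (-1) Gu' Gu; rewrite (scaleN1r v) addNr.
have /choice[f fP] v : exists u, Gr v u.
  by have [n [i [c ->]]] := b_span v; eexists; exists n, i, c.
have f_lin : linear f.
  by move=> a u v; apply: Gr_fun (fP _) _; apply: GrD.
pose F : {linear V -> W} := HB.pack f (GRing.isLinear.Build K V W *:%R f f_lin).
exists F => i; apply: Gr_fun (fP _) _.
by exists 1, (fun=> i), (fun=> 1); rewrite !big_ord1 !scale1r.
Qed.

End LinearExtension.

Section RegularModule.
Local Open Scope ring_scope.
Import GRing.Theory.

(** [V] becomes a direct sum of copies of [A] on which [G] acts by left multiplication through the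
    [phi i]. Here [e] is bijective: fixing leftover basis vectors would not be additive in [G], and
    killing them would not be unital. *)
Lemma End_embedding (K : fieldType) (V : lmodType K) (G A : algType K)
    (I B O : Type) (phi : I -> {lrmorphism G -> A}) (a : B -> A) (b : O -> V)
    (e : I * B -> O) :
  jointly_injective phi -> is_basis a -> is_basis b -> bijective e ->
  exists f : {lrmorphism G -> End V}, injective f.
Proof.
move=> phi_inj a_basis b_basis [e' eK e'K].
have ext (W : lmodType K) (w : I -> B -> W) :
    exists f : {linear V -> W}, forall i z, f (b (e (i, z))) = w i z.
  have [f fE] := linear_extension (fun o => w (e' o).1 (e' o).2) b_basis.
  by exists f => i z; rewrite fE eK.
have /choice[iota iotaE] (i : I) :
    exists f : {linear A -> V}, forall z, f (a z) = b (e (i, z)).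
  exact: linear_extension.
have iota_inj i : injective (iota i).
  (* The projection of [V] onto copy [i], zero on the other copies, is a left inverse. *)
  have [p pE] := ext _ (fun j z => if pselect (j = i) then a z else 0).
  apply: (can_inj (g := p)) => y; have [n [k [c ->]]] := a_basis.2 y.
  rewrite !linear_sum; apply: eq_bigr => j _.
  by rewrite !linearZ /= iotaE pE; case: pselect.
have /choice[rho rhoE] (x : G) : exists f : {linear V -> V},
    forall i z, f (b (e (i, z))) = iota i (phi i x * a z).
  exact: ext.
have rho_iota x i y : rho x (iota i y) = iota i (phi i x * y).
  have [n [k [c ->]]] := a_basis.2 y.
  rewrite mulr_sumr !linear_sum; apply: eq_bigr => j _.
  by rewrite -scalerAr !linearZ /= iotaE rhoE.
have rho_ext (f g : End V) :
    (forall i y, end_fun f (iota i y) = end_fun g (iota i y)) -> f = g.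
  move=> fg; apply: end_ext; apply: linear_ext_eq b_basis.2 _ => o.
  by rewrite -(e'K o) [e' o]surjective_pairing -iotaE.
pose f (x : G) : End V := rho x.
have f_lin : linear f.
  move=> c x y; apply: rho_ext => i z; rewrite /= /f /=.
  by rewrite !rho_iota linearP mulrDl linearD -scalerAl linearZ.
have f_mul : monoid_morphism f.
  split=> [|x y]; apply: rho_ext => i z; rewrite /= /f /= !rho_iota.
    by rewrite rmorph1 mul1r.
  by rewrite rmorphM mulrA.
pose F : {lrmorphism G -> End V} := HB.pack f
  (GRing.isLinear.Build K G (End V) *:%R f f_lin)
  (GRing.isMonoidMorphism.Build G (End V) f f_mul).
exists F => x y xy; apply: phi_inj => i; apply: (iota_inj i).
have := congr1 (fun g => end_fun g (iota i 1)) xy.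
by rewrite /= /f /end_fun !rho_iota !mulr1.
Qed.

End RegularModule.

(** * Lattices: Whitman's theorem *)

Section MeetRepresentation.
Local Open Scope order_scope.
Import Order.TTheory.
Variables (d : Order.disp_t) (L : latticeType d).
Implicit Types a b w : L.

(* A meet homomorphism from [L] to the equivalence relations on [carrier]; iterating
   [extend] below makes it preserve joins as well. *)
Record meet_rep := MeetRep {
  carrier :> Type;
  sim : L -> carrier -> carrier -> Prop;
  sim_refl : forall a x, sim a x x;
  sim_sym : forall a x y, sim a x y -> sim a y x;
  sim_trans : forall a x y z, sim a x y -> sim a y z -> sim a x z;
  simI : forall a b x y, sim (a `&` b) x y <-> sim a x y /\ sim b x y
}.

Arguments sim : clear implicits.

Lemma sim_le (X : meet_rep) a b (x y : X) :
  a <= b -> sim X a x y -> sim X b x y.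
Proof. by rewrite leEmeet => /eqP <- /simI[]. Qed.

(** * Adjoining witnesses for joins *)

Section OneStep.
Variable X : meet_rep.

Record gadget := Gadget {
  src : X; tgt : X; fst_label : L; snd_label : L;
  gadgetP : sim X (fst_label `|` snd_label) src tgt
}.

(* For each instance of [sim (a `|` b) x y], points [Z1], [Z2], [Z3] are added
   with [x ~a Z1 ~b Z2 ~a Z3 ~b y]. *)
Inductive extension := Old of X | Z1 of gadget | Z2 of gadget | Z3 of gadget.

Definition anchor (u : extension) : X :=
  match u with Old x => x | Z1 g | Z2 g => src g | Z3 g => tgt g end.

(** The labels on the path from [u] to its anchor are all below [w]; from [Z2] the path runs through
    [Z1] to the source. *)
Definition anchored w (u : extension) : Prop :=
  match u with
  | Old _ => True
  | Z1 g => fst_label g <= w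
  | Z2 g => fst_label g <= w /\ snd_label g <= w
  | Z3 g => snd_label g <= w
  end.

(* Jonsson's distance, as a relation: two points are identified by [w] inside a
   gadget ([near]) or by way of their anchors ([far]). *)
Definition far w u v : Prop :=
  [/\ anchored w u, anchored w v & sim X w (anchor u) (anchor v)].

Definition near w u v : Prop :=
  match u, v with
  | Old x, Old y => x = y
  | Z1 g, Z1 h | Z2 g, Z2 h | Z3 g, Z3 h => g = h
  | Z1 g, Z2 h | Z2 g, Z1 h => g = h /\ snd_label g <= w
  | Z2 g, Z3 h | Z3 g, Z2 h => g = h /\ fst_label g <= w
  | _, _ => False
  end.

Definition ext_rel w u v : Prop := near w u v \/ far w u v.

(** A path through a whole gadget joins only points of [X] that are already related; transitivity of
    [ext_rel] rests on this. *)
Lemma gadget_rel g w :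
  fst_label g <= w -> snd_label g <= w -> sim X w (src g) (tgt g).
Proof. by move=> aw bw; apply: sim_le (gadgetP g); rewrite leUx aw bw. Qed.

Lemma near_refl w u : near w u u. Proof. by case: u. Qed.

Lemma near_sym w u v : near w u v -> near w v u.
Proof.
by case: u v => [x|g|g|g] [y|h|h|h] //=; first [by move=> -> | by case=> ->].
Qed.

Lemma far_sym w u v : far w u v -> far w v u.
Proof. by move=> [uw vw /sim_sym]. Qed.

(** A near step to an anchored point starts at an anchored one; the anchors agree, except between
    [Z2] and [Z3], where [gadget_rel] relates them. *)
Lemma near_far w u v t : near w u v -> far w v t -> far w u t.
Proof.
suff H : near w u v -> anchored w v ->
    anchored w u /\ sim X w (anchor u) (anchor v).
  move=> /H{}H [vw tw vt]; have [uw uv] := H vw; split=> //.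
  exact: sim_trans uv vt.
case: u v => [x|g|g|g] [y|h|h|h] //=.
- by move=> ->; split=> //; apply: sim_refl.
- by move=> ->; split=> //; apply: sim_refl.
- by move=> [->] _ []; split=> //; apply: sim_refl.
- by move=> [->]; split=> //; apply: sim_refl.
- by move=> ->; split=> //; apply: sim_refl.
- by move=> [->]; split=> //; apply: gadget_rel.
- by move=> [->] ? []; split=> //; apply/sim_sym/gadget_rel.
- by move=> ->; split=> //; apply: sim_refl.
Qed.

(** Only passing between [Z1] and [Z3] leaves [near]; then both labels are below [w] and the two
    points are [far] related. *)
Lemma near_near w u v t : near w u v -> near w v t -> ext_rel w u t.
Proof.
case: u v t => [x|g|g|g] [y|h|h|h] [z|k|k|k] //=;
  try by do ?[case=> ? ?]; subst; left.
- by move=> [<- bw] [<- aw]; right; split=> //=; apply: gadget_rel.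
- by move=> [<- aw] [<- bw]; right; split=> //=; apply/sim_sym/gadget_rel.
Qed.

Lemma ext_rel_refl w u : ext_rel w u u. Proof. by left; apply: near_refl. Qed.

Lemma ext_rel_sym w u v : ext_rel w u v -> ext_rel w v u.
Proof. by case=> [/near_sym|/far_sym]; [left | right]. Qed.

Lemma ext_rel_trans w u v t : ext_rel w u v -> ext_rel w v t -> ext_rel w u t.
Proof.
case=> [uv|uv] [vt|vt].
- exact: near_near uv vt.
- by right; apply: near_far uv vt.
- by right; apply/far_sym/(near_far (near_sym vt))/far_sym.
- case: uv vt => [uw vw uv] [_ tw vt]; right; split=> //.
  exact: sim_trans uv vt.
Qed.

Lemma anchoredI a b u : anchored (a `&` b) u <-> anchored a u /\ anchored b u.
Proof.
case: u => [x|g|g|g] //=; rewrite ?lexI.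
- by split=> [/andP|[-> ->]].
- by split=> [[/andP[-> ->] /andP[-> ->]]|[[-> ->] [-> ->]]].
- by split=> [/andP|[-> ->]].
Qed.

Lemma nearI a b u v : near (a `&` b) u v <-> near a u v /\ near b u v.
Proof.
by case: u v => [x|g|g|g] [y|h|h|h] //=; rewrite ?lexI;
  split=> [|[]]; do ?[case]; do ?[move=> -> | move/andP=> [] | move=> ?].
Qed.

Lemma farI a b u v : far (a `&` b) u v <-> far a u v /\ far b u v.
Proof.
split=> [[/anchoredI[? ?] /anchoredI[? ?] /simI[? ?]] //|[[? ? ?] [? ? ?]]].
by split; [apply/anchoredI | apply/anchoredI | apply/simI].
Qed.

(** Distinct near points are [Z2] and a neighbour; anchoring [Z2] puts both labels below [b]. This
    settles the mixed cases of [ext_relI]. *)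
Lemma far_near a b u v : near a u v -> far b u v -> near b u v.
Proof.
case: u v => [x|g|g|g] [y|h|h|h] //= uv [/= gb hb _] //.
all: by case: uv => E _; subst h; tauto.
Qed.

Lemma ext_relI a b u v :
  ext_rel (a `&` b) u v <-> ext_rel a u v /\ ext_rel b u v.
Proof.
split=> [[/nearI[? ?]|/farI[? ?]]|[[ua|ua] [ub|ub]]].
- by split; left.
- by split; right.
- by left; apply/nearI.
- by left; apply/nearI; split=> //; apply: far_near ua ub.
- by left; apply/nearI; split=> //; apply: far_near ub ua.
- by right; apply/farI.
Qed.

Definition extend : meet_rep :=
  MeetRep ext_rel_refl ext_rel_sym ext_rel_trans ext_relI.

(** Old points gain no relations, so the stages of the chain are compatible. *)
Lemma ext_rel_Old w x y : ext_rel w (Old x) (Old y) <-> sim X w x y.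
Proof.
split=> [[/= ->|[]//]|xy]; first exact: sim_refl.
by right.
Qed.

Lemma embeds_extend (O : Type) :
  embeds nat O -> embeds L O -> embeds X O -> embeds extension O.
Proof.
move=> natO LO XO.
have gadget_inj :
    injective (fun g => (src g, tgt g, (fst_label g, snd_label g))).
  move=> [x y a b xy] [x' y' a' b' xy'] /= [? ? ? ?]; subst.
  by rewrite (Prop_irrelevance xy xy').
have gO : embeds gadget O.
  have := embeds_prod natO (embeds_prod natO XO XO) (embeds_prod natO LO LO).
  by apply: embeds_trans; eexists; apply: gadget_inj.
have := embeds_sum natO (embeds_sum natO XO gO) (embeds_sum natO gO gO).
apply: embeds_trans; exists (fun u => match u with
  | Old x => inl (inl x) | Z1 g => inl (inr g)
  | Z2 g => inr (inl g) | Z3 g => inr (inr g) end).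
by case=> [x|g|g|g] [y|h|h|h] // [->].
Qed.

End OneStep.

(** * The chain of extensions and its limit *)

Definition base_rel w (x y : L * bool) : Prop :=
  x = y \/ x.1 = y.1 /\ x.1 <= w.

Definition base_rep : meet_rep.
Proof.
apply: (@MeetRep _ base_rel).
- by left.
- by move=> w x y [->|[xy xw]]; [left | right; rewrite -xy].
- move=> w x y z [->|[xy xw]] // [<-|[yz yw]]; first by right.
  by right; rewrite xy.
- move=> a b x y; rewrite /base_rel lexI; split=> [[->|[-> /andP[? ?]]]|].
  + by split; left.
  + by split; right.
  + by case=> [[->|[xy xa]] [|[_ xb]]]; [left|left|left|right; rewrite xa].
Defined.

Fixpoint rep_chain (n : nat) : meet_rep :=
  if n is n'.+1 then extend (rep_chain n') else base_rep.

(** The stages are not glued: a point and its later images stay distinct but are related under every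
    [w], which is harmless for equivalence relations. *)
Definition limit := {n & rep_chain n}.
Implicit Types p q r : limit.

(** Recursion on the target stage confines the cast to the stage of [p]; the result is [None] if
    that stage comes after [k]. *)
Fixpoint lift_to (k : nat) p : option (rep_chain k) :=
  match pselect (projT1 p = k) with
  | left e => Some (eq_rect _ (fun n => carrier (rep_chain n)) (projT2 p) k e)
  | right _ => match k with
               | 0 => None
               | k'.+1 => omap (@Old (rep_chain k')) (lift_to k' p)
               end
  end.

Lemma lift_to_self n (x : rep_chain n) : lift_to n (existT _ n x) = Some x.
Proof.
by case: n x => [|n] x; rewrite /lift_to;
  case: pselect => // e; rewrite eq_axiomK.
Qed.

Lemma lift_toS k p :
  (projT1 p <= k)%N -> lift_to k.+1 p = omap (@Old _) (lift_to k p).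
Proof.
by move=> pk /=; case: pselect => // e; exfalso; rewrite e ltnn in pk.
Qed.

Lemma lift_to_total k p : (projT1 p <= k)%N -> exists s, lift_to k p = Some s.
Proof.
case: p => n x /= /subnK <-; elim: (k - n)%N => [|j [s IH]].
  by exists x; rewrite lift_to_self.
by exists (Old s); rewrite lift_toS ?leq_addl // IH.
Qed.

Definition rel_at k w p q : Prop :=
  exists s t,
    [/\ lift_to k p = Some s, lift_to k q = Some t & sim (rep_chain k) w s t].

Definition limit_rel w p q : Prop :=
  rel_at (maxn (projT1 p) (projT1 q)) w p q.

(** By [ext_rel_Old] raising the stage by one changes nothing; three points can thus be compared at
    a common stage. *)
Lemma limit_relP k w p q : (projT1 p <= k)%N -> (projT1 q <= k)%N ->
  limit_rel w p q <-> rel_at k w p q.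
Proof.
move=> pk qk; have := leq_max (projT1 p) (projT1 p) (projT1 q).
have := leq_max (projT1 q) (projT1 p) (projT1 q).
rewrite /limit_rel !leqnn orbT; set m := maxn _ _ => qm pm.
have /subnK <- : (m <= k)%N by rewrite geq_max pk.
elim: (k - m)%N => [//|j IH].
have pj : (projT1 p <= j + m)%N by apply: leq_trans pm (leq_addl _ _).
have qj : (projT1 q <= j + m)%N by apply: leq_trans qm (leq_addl _ _).
rewrite IH addSn /rel_at !lift_toS //.
split=> [[s [t [-> -> st]]]|].
  by exists (Old s), (Old t); split=> //; apply/ext_rel_Old.
have [s ->] := lift_to_total pj; have [t ->] := lift_to_total qj.
by move=> [_ [_ [[<-] [<-] /ext_rel_Old st]]]; exists s, t.
Qed.

Lemma limit_rel_equiv w : Equivalence (limit_rel w).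
Proof.
split=> [p|p q|p q r].
- have [s ps] := lift_to_total (leqnn (projT1 p)).
  apply/(limit_relP w (leqnn _) (leqnn _)); exists s, s; split=> //.
  exact: sim_refl.
- move=> [s [t [ps qt st]]]; rewrite /limit_rel maxnC.
  by exists t, s; split=> //; apply: sim_sym.
- pose k := maxn (projT1 p) (maxn (projT1 q) (projT1 r)).
  have pk : (projT1 p <= k)%N by rewrite leq_maxl.
  have qk : (projT1 q <= k)%N by rewrite leq_max leq_maxl orbT.
  have rk : (projT1 r <= k)%N by rewrite leq_max leq_maxr orbT.
  move=> /(limit_relP w pk qk)[s [t [ps qt st]]].
  move=> /(limit_relP w qk rk)[t' [u [qt' ru tu]]].
  apply/(limit_relP w pk rk); exists s, u; split=> //.
  by move: qt'; rewrite qt => -[tt']; apply: sim_trans st _; rewrite tt'.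
Qed.

Definition limit_equiv w : Equiv limit := MkEquiv (limit_rel_equiv w).

Lemma limit_relI a b p q :
  limit_rel (a `&` b) p q <-> limit_rel a p q /\ limit_rel b p q.
Proof.
split=> [[s [t [ps qt /simI[sta stb]]]]|]; first by split; exists s, t.
move=> [[s [t [ps qt st]]] [s' [t' [ps' qt' st']]]].
exists s, t; split=> //; apply/simI; split=> //.
by move: ps' qt' st'; rewrite ps qt => -[->] [->].
Qed.

(** A pair related at stage [k] is the pair of ends of a gadget, whose four-step path exists at
    stage [k.+1]. *)
Lemma limit_relU a b p q : limit_rel (a `|` b) p q ->
  clos_trans limit (fun x y => limit_rel a x y \/ limit_rel b x y) p q.
Proof.
set k := maxn (projT1 p) (projT1 q).
have pk : (projT1 p <= k)%N by rewrite leq_maxl.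
have qk : (projT1 q <= k)%N by rewrite leq_maxr.
move=> [s [t [ps qt st]]]; pose g := Gadget st.
pose z (u : extension (rep_chain k)) : limit :=
  existT (fun n => carrier (rep_chain n)) k.+1 u.
have step w r r' u u' : (projT1 r <= k.+1)%N -> (projT1 r' <= k.+1)%N ->
    lift_to k.+1 r = Some u -> lift_to k.+1 r' = Some u' ->
    ext_rel w u u' -> limit_rel w r r'.
  by move=> rk r'k ru ru' uu'; apply/(limit_relP w rk r'k); exists u, u'.
have zk u : (projT1 (z u) <= k.+1)%N by [].
have zE u : lift_to k.+1 (z u) = Some u by rewrite lift_to_self.
have pE : lift_to k.+1 p = Some (Old s) by rewrite lift_toS // ps.
have qE : lift_to k.+1 q = Some (Old t) by rewrite lift_toS // qt.
apply: (t_trans _ _ _ (z (Z1 g))).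
  apply: t_step; left; apply: (step _ _ _ _ _ (leqW pk) (zk _) pE (zE _)).
  by right; split=> //=; apply: sim_refl.
apply: (t_trans _ _ _ (z (Z2 g))).
  apply: t_step; right.
  by apply: (step _ _ _ _ _ (zk _) (zk _) (zE _) (zE _)); left.
apply: (t_trans _ _ _ (z (Z3 g))).
  apply: t_step; left.
  by apply: (step _ _ _ _ _ (zk _) (zk _) (zE _) (zE _)); left.
apply: t_step; right; apply: (step _ _ _ _ _ (zk _) (leqW qk) (zE _) qE).
by right; split=> //=; apply: sim_refl.
Qed.

Lemma limit_equivI a b :
  limit_equiv (a `&` b) = limit_equiv a `&` limit_equiv b.
Proof. by apply: equiv_ext => p q; apply: limit_relI. Qed.

Lemma limit_equivU a b :
  limit_equiv (a `|` b) = limit_equiv a `|` limit_equiv b.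
Proof.
apply/le_anti/andP; split; first by apply/asboolP => p q; apply: limit_relU.
have mono x y : x <= y -> limit_equiv x <= limit_equiv y.
  by rewrite !leEmeet -limit_equivI => /eqP->.
by rewrite leUx !mono ?leUl ?leUr.
Qed.

Lemma limit_equiv_inj : injective limit_equiv.
Proof.
have H a b : limit_equiv a = limit_equiv b -> a <= b.
  (* The two base points over [a] are related by [a], hence by [b]; as they are distinct, this
     forces [a <= b]. *)
  pose z i : limit := existT (fun n => carrier (rep_chain n)) 0 (a, i).
  move=> /(congr1 (fun R : Equiv limit => R (z false) (z true))) /= E.
  have : limit_rel a (z false) (z true).
    exists (a, false), (a, true).
    by split; [exact: lift_to_self|exact: lift_to_self|right].
  by rewrite E => -[s [t []]]; rewrite !lift_to_self => -[<-] [<-] [//|[]].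
by move=> a b ab; apply/le_anti; rewrite !H.
Qed.

Lemma embeds_limit (O : Type) : embeds nat O -> embeds L O -> embeds limit O.
Proof.
move=> natO LO; apply: embeds_sigT => // n.
elim: n => [|n IH]; last exact: embeds_extend.
apply: embeds_prod => //; have [i iI] := natO.
by exists (fun c : bool => i c) => -[] [] // /iI.
Qed.

End MeetRepresentation.

(** * Equivalence relations side by side *)

Section EquivEmbedding.
Local Open Scope order_scope.
Import Order.TTheory.

(** Each relation is equality off the copies of [limit L] and never mixes copies, so meets and joins
    are computed within each copy. *)
Lemma Equiv_embedding (dG dL : Order.disp_t) (G : latticeType dG)
    (L : latticeType dL) (I O : Type) (phi : I -> {lmorphism G -> L}) :
  jointly_injective phi -> embeds (I * limit L) O ->
  exists f : {lmorphism G -> Equiv O}, injective f.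
Proof.
move=> phi_inj [e e_inj].
pose psi i x := limit_equiv (phi i x).
have psiI i x y s t : psi i (x `&` y) s t <-> psi i x s t /\ psi i y s t.
  by rewrite /psi omorphI limit_equivI.
have psiU i x y s t : psi i (x `|` y) s t ->
    clos_trans _ (fun u v => psi i x u v \/ psi i y u v) s t.
  by rewrite /psi omorphU limit_equivU.
pose R x p q := p = q \/
  exists i s t, [/\ p = e (i, s), q = e (i, t) & psi i x s t].
have RE x i s t : R x (e (i, s)) (e (i, t)) <-> psi i x s t.
  split=> [[/e_inj[->]|[j [s' [t' [/e_inj[-> ->] /e_inj[->]]]]]]|st] //.
    by have [rr _ _] := equiv_equiv (psi i x); apply: rr.
  by right; exists i, s, t.
have R_equiv x : Equivalence (R x).
  split=> [p|p q|p q r]; first by left.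
  - case=> [->|[i [s [t [-> -> /= st]]]]]; first by left.
    by apply/RE; have [_ rs _] := equiv_equiv (psi i x); apply: rs.
  - case=> [->|[i [s [t [-> -> /= st]]]]] //.
    case=> [<-|[j [t' [u [/e_inj[<- <-] -> /= tu]]]]]; first exact/RE.
    by apply/RE; have [_ _ rt] := equiv_equiv (psi i x); apply: rt st tu.
pose f x := MkEquiv (R_equiv x).
have fI : Order.meet_morphism f.
  move=> x y; apply: equiv_ext => p q /=.
  split=> [[->|[i [s [t [-> -> /= st]]]]]|].
  - by split; left.
  - by have /psiI[sx sy] := st; split; apply/RE.
  - move=> [/= [->|[i [s [t [-> -> sx]]]]] ]; first by left.
    by move=> /RE sy; apply/RE/psiI.
have f_mono x y : x <= y -> f x <= f y by rewrite !leEmeet -fI => /eqP->.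
have fU : Order.join_morphism f.
  move=> x y; apply/le_anti/andP; split; last first.
    by rewrite leUx !f_mono ?leUl ?leUr.
  apply/asboolP => p q /= [->|[i [s [t [-> -> /psiU]]]]].
    by apply: t_step; left; left.
  elim=> [u v [uv|uv]|u v w _ uv _ vw].
  - by apply: t_step; left; apply/RE.
  - by apply: t_step; right; apply/RE.
  - exact: t_trans uv vw.
pose F0 : {omorphism G -> Equiv O} := HB.pack f
  (Order.isOrderMorphism.Build _ G _ (Equiv O) f f_mono).
pose F : {lmorphism G -> Equiv O} := HB.pack f F0
  (Order.isLatticeMorphism.Build _ G _ (Equiv O) F0 fI fU).
exists F => x y /(congr1 (fun r : Equiv O => r : O -> O -> Prop)) /= fxy.
apply: phi_inj => i; apply: limit_equiv_inj; apply: equiv_ext => s t.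
have Exy : R x = R y by [].
by rewrite -/(psi i x) -/(psi i y) -!RE Exy.
Qed.

End EquivEmbedding.

Theorem theorem3p2 (Omega : Type) (K : fieldType) (V : lmodType K)
    (b : Omega -> V) (Omega_infinite : infinite_set [set: Omega])
    (b_basis : is_basis b) :
  [/\ forall F : group_functor,
        finitary F -> [set: F nat] #<= [set: Omega] ->
        exists f : UMagmaMorphism.type (F (Omega -> bool)) (Sym Omega),
          injective f,
      forall F : monoid_functor,
        finitary F -> [set: F nat] #<= [set: Omega] ->
        exists f : UMagmaMorphism.type (F (Omega -> bool)) (Self Omega),
          injective f,
      forall F : algebra_functor K,
        finitary F -> dim_le (F nat) Omega ->
        exists f : {lrmorphism F (Omega -> bool) -> End V},
          injective f
    & forall (d : Order.disp_t) (F : lattice_functor d),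
        finitary F -> [set: F nat] #<= [set: Omega] ->
        exists f : {lmorphism F (Omega -> bool) -> Equiv Omega},
          injective f].
Proof.
have natO : embeds nat Omega by apply/embedsP/infiniteP.
have idO : embeds Omega Omega by exists id.
split=> [F|F|F|d F] finF; have [c c_inj] := finitary_separation finF natO.
- move=> /embedsP FO.
  apply: (Sym_embedding (phi := fun o => fmap F (c o))) => //.
  exact: embeds_prod.
- move=> /embedsP FO.
  apply: (Self_embedding (phi := fun o => fmap F (c o))) => //.
  exact: embeds_prod.
- move=> [B [a [a_basis /embedsP BO]]].
  (* As 1 is nonzero, [B] is inhabited; so [Omega] embeds in [Omega * B], and Cantor-Bernstein gives
     the bijection. *)
  have [n [i one]] := a_basis.2 (1%R : F nat).
  have [e e_bij] : exists e : Omega * B -> Omega, bijective e.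
    apply: embeds_antisym; first exact: embeds_prod.
    have [z0] : inhabited B.
      case: n i one => [|n] i; last by split; apply: i ord0.
      by move=> [k]; rewrite big_ord0 => /eqP; rewrite GRing.oner_eq0.
    by exists (fun o => (o, z0)) => x y [].
  apply: (End_embedding (phi := fun o => fmap F (c o)) c_inj a_basis b_basis).
  exact: e_bij.
- move=> /embedsP FO.
  apply: (Equiv_embedding (phi := fun o => fmap F (c o))) => //.
  by apply: embeds_prod => //; apply: embeds_limit.
Qed.
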